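(* For each $\epsilon \in (0,1]$, there exists $k \in \{0, 1, \infty\}$ such that for $\mathbb{P}_\epsilon$-almost every $\omega \in \mathbb{E}$, $N_\omega = k$.
   Context: Let $\overrightarrow{G}$ be the directed graph with vertex set $\mathbb{Z}^2$ and edge set $E = \{(a, a \pm e_i) : a \in \mathbb{Z}^2,\ i = 1,2\}$, where $e_1, e_2$ are the unit coordinate vectors; adjacent vertices are called neighbors. The space of vertex configurations is $\mathbb{V} = [0,1]^{\mathbb{Z}^2}$ with the product topology, its Borel $\sigma$-algebra, and Lebesgue product measure $\lambda$ (so the values $\phi_a$, $a\in\mathbb{Z}^2$, are i.i.d. uniform on $[0,1]$). The space of edge configurations is $\mathbb{E} = \{\bullet, \to\}^E$ with the product topology and Borel $\sigma$-algebra, where $\to$ means the directed edge is present (open) and $\bullet$ means it is absent; thus each $\omega\in\mathbb{E}$ is viewed as a directed subgraph of $\overrightarrow{G}$ with vertex set $\mathbb{Z}^2$. For $\epsilon \in [0,1]$ define $f_\epsilon : \mathbb{V} \to \mathbb{E}$ by: for $(a,b) \in E$, $f_\epsilon(\phi)_{(a,b)} = \;\to$ if $\phi_b < \phi_a + \epsilon$, and $\bullet$ otherwise. Let $\mathbb{P}_\epsilon = \lambda \circ f_\epsilon^{-1}$, a probability measure on $\mathbb{E}$. A path from $a$ to $b$ in $\omega$ is a finite sequence of distinct vertices $a = a_0, a_1, \dots, a_n = b$ such that each $(a_i,a_{i+1})$ is an open edge of $\omega$. The strongly connected cluster (strong cluster) of $a$ in $\omega$ is the set of all $b \in \mathbb{Z}^2$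 such that there are both a path from $a$ to $b$ and a path from $b$ to $a$ in $\omega$. For $\omega \in \mathbb{E}$, $N_\omega \in \{0,1,2,\dots\}\cup\{\infty\}$ denotes the number of infinite strong clusters in $\omega$. *)

(* Defs.v *)
From HB Require Import structures.
From mathcomp Require Import all_boot all_order all_algebra.
From mathcomp Require Import all_classical all_reals all_analysis.

Set Implicit Arguments.
Unset Strict Implicit.
Unset Printing Implicit Defensive.

Import Order.TTheory GRing.Theory Num.Theory.
Import numFieldTopology.Exports.

Local Open Scope classical_set_scope.
Local Open Scope ring_scope.

Definition vertex : Type := (int * int)%type.

Definition e1 : vertex := (1, 0).
Definition e2 : vertex := (0, 1).

Definition neighbors (a b : vertex) : bool :=
  b \in [:: a + e1; a - e1; a + e2; a - e2].

Definition edge : Type := {ab : vertex * vertex | neighbors ab.1 ab.2}.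

Section configurations.
Variable R : realType.

Definition unit_interval : Type := [set` `[0 : R, 1 : R]].
HB.instance Definition _ := Topological.on unit_interval.

Lemma unit_interval0 : (0 : R) \in [set` `[0 : R, 1 : R]].
Proof. by rewrite inE /= in_itv /= lexx ler01. Qed.

HB.instance Definition _ :=
  isPointed.Build unit_interval (exist _ (0 : R) unit_interval0).

Definition vertex_space : Type := {ptws vertex -> unit_interval}.
HB.instance Definition _ := Topological.on vertex_space.
HB.instance Definition _ :=
  isPointed.Build vertex_space (fun=> point : unit_interval).

Definition vertex_config := g_sigma_algebraType (@open vertex_space).
HB.instance Definition _ := Measurable.on vertex_config.

(* [true] stands for an open edge and [false] for an absent one. *)
Definition edge_space : Type := {ptws edge -> bool}.
HB.instance Definition _ := Topological.on edge_space.
HB.instance Definition _ := isPointed.Build edge_space (fun=> false).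

Definition edge_config := g_sigma_algebraType (@open edge_space).
HB.instance Definition _ := Measurable.on edge_config.

(* Kolmogorov: exactly one probability measure on the Borel sets of
   [0,1]^(Z^2) satisfies this. The Borel sets of [0,1] are the traces on [0,1]
   of those of R, hence the intersection with [0,1] on the right. *)
Definition lebesgue_product_measure (lambda : probability vertex_config R) :=
  forall (s : seq vertex) (A : vertex -> set R),
    uniq s -> (forall a, measurable (A a)) ->
    lambda [set phi : vertex_config | forall a, a \in s -> A a (set_val (phi a))] =
    (\prod_(a <- s) lebesgue_measure (A a `&` [set` `[0%R : R, 1%R : R]]))%E.

Definition threshold_map (eps : R) (phi : vertex_config) : edge_config :=
  fun ab : edge =>
    set_val (phi (val ab).2) < set_val (phi (val ab).1) + eps.

(* The probability measure P_eps on edge configurations. *)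
Definition edge_law (lambda : probability vertex_config R) (eps : R) :
  set edge_config -> \bar R := pushforward lambda (threshold_map eps).

End configurations.

Section clusters.
Variable w : edge_config.

Definition open_edge (a b : vertex) : bool :=
  if insub (a, b) is Some ab then w ab else false.

Definition has_path (a b : vertex) : Prop :=
  exists p : seq vertex, [/\ path open_edge a p, uniq (a :: p) & last a p = b].

Definition strong_cluster (a : vertex) : set vertex :=
  [set b | has_path a b /\ has_path b a].

Definition infinite_strong_clusters : set (set vertex) :=
  [set C | infinite_set C /\ exists a, C = strong_cluster a].

End clusters.

(* N_w, with value +oo if there are infinitely many infinite clusters. *)
Definition nb_infinite_clusters (R : realType) (w : edge_config) : \bar R :=
  counting (infinite_strong_clusters w).

(* Main.v *)
Require Import Defs.
From mathcomp Require Import all_boot all_order all_algebra.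
From mathcomp Require Import all_classical all_reals all_analysis.
From mathcomp Require Import lra measurable_realfun.

(** The number of infinite strong clusters is almost surely constant because
    it is invariant under the translations of the lattice, and translations
    are mixing for the product measure ([zero_one_law]).  What remains is to
    exclude a constant [k] with [2 <= k < oo].

    The vertex values are changed one at a time.  The change used is a rotation
    of the unit interval by a rational angle, applied to one coordinate: it
    preserves the product measure ([rotate_at_preserves]), and finite sequences
    of such rotations form a countable set, so some configuration keeps exactly
    [k] infinite clusters after every such sequence.  From there on the argument
    is deterministic.

    Suppose that the value at [v] is raised from [x] to [y], and that every
    neighbor of [v] has a value above [y - eps].  No edge is closed: edges out
    of [v] only become easier to open, and edges into [v] are open afterwards.
    Both the old and the new configuration have [k] infinite clusters, and all
    new connections go through [v].  If two old infinite clusters were merged,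
    the merged cluster would contain [v]; the [k - 1] other new infinite
    clusters avoid [v], hence were clusters already, and together with the two
    merged ones they would make [k + 1] infinite clusters in the old
    configuration.  So nothing is merged ([separated_merging]).

    Such raises can be iterated.  A vertex can be lifted above level [c] once
    all its neighbors are above [c - eps / 2], so by induction on the number of
    levels any finite set of vertices can be brought above [1 - eps]
    ([raise_to_level]).  Apply this to a lattice walk joining two vertices of
    distinct infinite clusters: between neighbors above [1 - eps] both edges are
    open, so the two clusters have been merged, a contradiction
    ([finite_number_le1]). *)

Set Implicit Arguments.
Unset Strict Implicit.
Unset Printing Implicit Defensive.

Import Order.TTheory GRing.Theory Num.Theory.
Import numFieldTopology.Exports.
Local Open Scope classical_set_scope.
Local Open Scope ring_scope.


(** * Strong clusters and their number *)

Lemma le_counting (T : choiceType) (R : realType) (A : set T) (n : nat) :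
  ((n%:R%:E : \bar R) <= counting A)%E <->
  exists L : seq T, [/\ uniq L, size L = n & forall x, x \in L -> A x].
Proof.
rewrite /counting; case: ifPn => /asboolP finA.
  rewrite lee_fin ler_nat; split.
    move=> nA; exists (take n (finmap.enum_fset (fset_set A))); split.
    - by rewrite take_uniq.
    - by rewrite size_takel.
    - by move=> x /mem_take; rewrite in_fset_set// inE.
  move=> [L [uL <- LA]]; apply: uniq_leq_size => // x /LA Ax.
  by rewrite in_fset_set// inE.
split=> [_|_]; last by rewrite leey.
have [B BA nB] := infinite_set_fset n finA.
exists (take n (finmap.enum_fset B)); split.
- by rewrite take_uniq.
- by rewrite size_takel.
- by move=> x /mem_take xB; exact: BA.
Qed.

Section graph.
Variable w : edge_config.

Lemma has_pathP (a b : vertex) :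
  has_path w a b <-> exists2 p, path (open_edge w) a p & last a p = b.
Proof.
split=> [[p [pp _ lp]]|[p pp lp]]; first by exists p.
by case/shortenP: pp lp => q pq uq _ lq; exists q.
Qed.

Lemma has_path_refl a : has_path w a a.
Proof. by apply/has_pathP; exists [::]. Qed.

Lemma has_path_trans b a c : has_path w a b -> has_path w b c -> has_path w a c.
Proof.
move=> /has_pathP[p pp lp] /has_pathP[q pq lq]; apply/has_pathP.
by exists (p ++ q); rewrite ?cat_path ?last_cat ?pp ?lp.
Qed.

Lemma strong_cluster_refl a : strong_cluster w a a.
Proof. by split; exact: has_path_refl. Qed.

Lemma strong_cluster_sym a b : strong_cluster w a b -> strong_cluster w b a.
Proof. by case. Qed.

Lemma strong_cluster_trans b a c :
  strong_cluster w a b -> strong_cluster w b c -> strong_cluster w a c.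
Proof.
by move=> [ab ba] [bc cb]; split; [exact: has_path_trans ab bc|exact: has_path_trans cb ba].
Qed.

Lemma eq_strong_cluster a b :
  strong_cluster w a b <-> strong_cluster w a = strong_cluster w b.
Proof.
split=> [ab|->]; last exact: strong_cluster_refl.
apply/seteqP; split=> c; apply: strong_cluster_trans => //.
exact: strong_cluster_sym.
Qed.

(** Clusters are counted through lists of representatives: such lists range
    over a countable type, as the measurability proof needs, and are easy to
    compare in two graphs. *)
Definition separated (s : seq vertex) :=
  [/\ uniq s, forall a : vertex, a \in s -> infinite_set (strong_cluster w a) &
      forall a b : vertex, a \in s -> b \in s -> strong_cluster w a b -> a = b].

Lemma le_nb_infinite_clusters (R : realType) (n : nat) :
  ((n%:R%:E : \bar R) <= nb_infinite_clusters R w)%E <->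
  exists2 s, separated s & size s = n.
Proof.
rewrite le_counting; split.
  move=> [L [uL <- LI]].
  pose r (C : set vertex) : vertex := xget (0, 0) [set a | C = strong_cluster w a].
  have rL C : C \in L -> C = strong_cluster w (r C).
    by move=> /LI[_ [a Ca]]; rewrite /r; case: xgetP => [x _ //|/(_ a)].
  exists (map r L); last by rewrite size_map.
  split.
  - rewrite map_inj_in_uniq// => C D /rL CE /rL DE rE.
    by rewrite CE rE -DE.
  - move=> a /mapP[C CL ->]; rewrite -rL//.
    by have [] := LI _ CL.
  - move=> a b /mapP[C CL ->] /mapP[D DL ->] /eq_strong_cluster.
    by rewrite -!rL// => ->.
move=> [s [us si sd] <-]; exists (map (strong_cluster w) s); split.
- by rewrite map_inj_in_uniq// => a b sa sb /eq_strong_cluster; exact: sd.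
- by rewrite size_map.
- by move=> C /mapP[a sa ->]; split; [exact: si|exists a].
Qed.

Lemma nb_infinite_clusters_eq_nat (R : realType) (n : nat) :
  nb_infinite_clusters R w = n%:R%:E <->
  (exists2 s, separated s & size s = n) /\
  ~ (exists2 s, separated s & size s = n.+1).
Proof.
rewrite -!(le_nb_infinite_clusters R).
rewrite /nb_infinite_clusters /counting; case: ifP => _.
  rewrite !lee_fin !ler_nat; split=> [[]/eqP|[h1 h2]].
    by rewrite eqr_nat => /eqP->; rewrite ltnn.
  by congr (_%:R%:E); apply/eqP; rewrite eqn_leq h1 andbT leqNgt; apply/negP.
by rewrite !leey; split=> // -[_ []].
Qed.

Lemma nb_infinite_clusters_eq_pinfty (R : realType) :
  nb_infinite_clusters R w = +oo%E <->
  forall n, exists2 s, separated s & size s = n.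
Proof.
split=> [h n|h]; first by apply/(le_nb_infinite_clusters R); rewrite h leey.
have {}h n := (le_nb_infinite_clusters R n).2 (h n).
move: h; rewrite /nb_infinite_clusters /counting; case: ifP => // _.
move=> /(_ (size (finmap.enum_fset (fset_set (infinite_strong_clusters w)))).+1).
by rewrite lee_fin ler_nat ltnn.
Qed.

Lemma nb_infinite_clusters_nat_or_pinfty (R : realType) :
  exists o : option nat,
    nb_infinite_clusters R w = if o is Some n then n%:R%:E else +oo%E.
Proof.
rewrite /nb_infinite_clusters /counting; case: ifP => _; last by exists None.
by exists (Some (size (finmap.enum_fset (fset_set (infinite_strong_clusters w))))).
Qed.

End graph.

(** * Opening edges at a single vertex *)

Section merging.
Variables (w w' : edge_config) (v : vertex).
Hypothesis ww' : forall a b, open_edge w a b -> open_edge w' a b.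
Hypothesis w'w : forall a b : vertex, a != v -> b != v -> open_edge w' a b -> open_edge w a b.

Lemma has_path_mono a b : has_path w a b -> has_path w' a b.
Proof.
move=> /has_pathP[p pp lp]; apply/has_pathP; exists p => //.
exact: sub_path pp.
Qed.

Lemma strong_cluster_mono a : strong_cluster w a `<=` strong_cluster w' a.
Proof. by move=> b [ab ba]; split; exact: has_path_mono. Qed.

(** A path that avoids [v] uses old edges only; any other path can be cut
    at [v]. *)
Lemma has_path_avoid a b : has_path w' a b ->
  has_path w a b \/ has_path w' a v /\ has_path w' v b.
Proof.
move=> /has_pathP[p pp lp].
have [vp|vp] := boolP (v \in a :: p).
  right; case/splitPl: vp pp lp => p1 p2 lp1.
  rewrite cat_path last_cat lp1 => /andP[pp1 pp2] lp2.
  by split; apply/has_pathP; [exists p1|exists p2].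
left; apply/has_pathP; exists p => //.
elim: p a pp {lp} vp => //= c p IH a /andP[ac cp].
rewrite !in_cons !negb_or => /and3P[av cv vp].
by rewrite w'w// ?IH// 1?eq_sym// in_cons negb_or cv.
Qed.

Lemma strong_cluster_new a b : strong_cluster w' a b ->
  strong_cluster w a b \/ strong_cluster w' v a.
Proof.
move=> [ab ba].
have [ab'|[av vb]] := has_path_avoid ab; last first.
  by right; split=> //; exact: has_path_trans vb ba.
have [ba'|[bv va]] := has_path_avoid ba; first by left.
by right; split=> //; exact: has_path_trans ab bv.
Qed.

(** Every new connection passes through [v], so only the cluster of [v]
    changes. *)
Lemma strong_cluster_away a : ~ strong_cluster w' v a ->
  strong_cluster w' a = strong_cluster w a.
Proof.
move=> va; apply/seteqP; split=> [b|]; last exact: strong_cluster_mono.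
by move=> /strong_cluster_new[].
Qed.

(** If two members [a] and [b] of [s] were merged, their new cluster would be
    that of [v].  Among the representatives [t] of the new infinite clusters, at
    most one lies in it; the others represent old infinite clusters as well, and
    adding [a] and [b] to them gives [size s + 1] old infinite clusters. *)
Lemma separated_merging (s : seq vertex) :
  ~ (exists2 t, separated w t & size t = (size s).+1) ->
  (exists2 t, separated w' t & size t = size s) ->
  separated w s -> separated w' s.
Proof.
move=> Nt [t [ut ti td] tsz] [us si sd]; split=> //.
  move=> a /si; apply: contra_not; apply: sub_finite_set.
  exact: strong_cluster_mono.
move=> a b sa sb ab; apply/eqP/negP => /negP neq_ab; apply: Nt.
have Nab : ~ strong_cluster w a b by move=> /sd -/(_ sa sb); exact/eqP.
have va : strong_cluster w' v a by have [] := strong_cluster_new ab.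
have vb := strong_cluster_trans va ab.
(* [t'] consists of the members of [t] outside the cluster of [v]; at most one
   member is lost because [t] is separated *)
have [t' [ut' t't t'v szt']] : exists t', [/\ uniq t', {subset t' <= t},
    forall c, c \in t' -> ~ strong_cluster w' v c & ((size t).-1 <= size t')%N].
  have [[c ct vc]|Nv] := pselect (exists2 c, c \in t & strong_cluster w' v c).
    exists (rem c t); split; first exact: rem_uniq.
    - by move=> x; exact: mem_rem.
    - move=> x; rewrite mem_rem_uniq// inE => /andP[xc xt] vx.
      move/eqP: xc; apply; apply: td => //.
      exact: strong_cluster_trans (strong_cluster_sym vx) vc.
    - by rewrite size_rem.
  exists t; split=> //; last exact: leq_pred.
  by move=> c ct vc; apply: Nv; exists c.
have Nin c x : strong_cluster w' v c -> x \in t' -> ~ strong_cluster w x c.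
  move=> vc xt' /strong_cluster_mono xc; apply: (t'v _ xt').
  exact: strong_cluster_trans vc (strong_cluster_sym xc).
have Nmem c : strong_cluster w' v c -> c \notin t'.
  by move=> vc; apply/negP => /(Nin _ _ vc); apply; exact: strong_cluster_refl.
have [sz2 sep2] : (size s < size (a :: b :: t'))%N /\ separated w (a :: b :: t').
  split.
    by rewrite -tsz /= ltnS (leq_trans (leqSpred _)).
  split.
  - by rewrite /= in_cons negb_or neq_ab !Nmem.
  - move=> c; rewrite !in_cons => /or3P[/eqP->|/eqP->|ct']; [exact: si|exact: si|].
    by rewrite -strong_cluster_away; [apply: ti; exact: t't|exact: t'v].
  - move=> c d; rewrite !in_cons => /or3P[/eqP->|/eqP->|ct'] /or3P[/eqP->|/eqP->|dt'] // cd.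
    + by move/strong_cluster_sym: cd => /(Nin _ _ va); move/(_ dt').
    + by have := Nab (strong_cluster_sym cd).
    + by move/strong_cluster_sym: cd => /(Nin _ _ vb); move/(_ dt').
    + by have := Nin _ _ va ct' cd.
    + by have := Nin _ _ vb ct' cd.
    + apply: td; [exact: t't|exact: t't|exact: strong_cluster_mono].
exists (take (size s).+1 (a :: b :: t')); last by rewrite size_takel.
case: sep2 => u i d; split; first by rewrite take_uniq.
- by move=> c /mem_take; exact: i.
- by move=> c e /mem_take cm /mem_take em; exact: d.
Qed.

End merging.

(** * Translation invariance *)

Lemma has_path_translate (w w' : edge_config) (u a b : vertex) :
  (forall x y, open_edge w' x y = open_edge w (x + u) (y + u)) ->
  has_path w' a b -> has_path w (a + u) (b + u).
Proof.
move=> ww' /has_pathP[p pp lp]; apply/has_pathP; exists [seq x + u | x <- p].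
  by elim: p a pp {lp} => //= x p IH a /andP[ax xp]; rewrite -ww' ax IH.
by rewrite (last_map (fun x : vertex => x + u)) lp.
Qed.

Lemma separated_translate (w w' : edge_config) (u : vertex) (s : seq vertex) :
  (forall a b, open_edge w' a b = open_edge w (a + u) (b + u)) ->
  separated w' s -> separated w [seq a + u | a <- s].
Proof.
move=> ww' [us si sd].
have w'w a b : open_edge w a b = open_edge w' (a - u) (b - u) by rewrite ww' !subrK.
have back a b : strong_cluster w (a + u) b -> strong_cluster w' a (b - u).
  by move=> [ab ba]; split; [have := has_path_translate w'w ab|
    have := has_path_translate w'w ba]; rewrite addrK.
split.
- by rewrite map_inj_uniq//; exact: addIr.
- move=> _ /mapP[a sa ->] fin; apply: (si a sa).
  apply: (@sub_finite_set _ _ ((fun b : vertex => b - u) @` strong_cluster w (a + u))).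
    move=> b [ab ba]; exists (b + u); last by rewrite addrK.
    by split; exact: has_path_translate.
  exact: finite_image.
- move=> _ _ /mapP[a sa ->] /mapP[b sb ->] /back; rewrite addrK => ab.
  by rewrite (sd a b).
Qed.

Lemma nb_infinite_clusters_translate (R : realType) (w w' : edge_config) (u : vertex) :
  (forall a b, open_edge w' a b = open_edge w (a + u) (b + u)) ->
  nb_infinite_clusters R w' = nb_infinite_clusters R w.
Proof.
move=> ww'.
have w'w a b : open_edge w a b = open_edge w' (a - u) (b - u) by rewrite ww' !subrK.
have sep n : (exists2 s, separated w s & size s = n) <->
             (exists2 s, separated w' s & size s = n).
  split=> -[s ss <-].
    by exists [seq a - u | a <- s]; rewrite ?size_map//; exact: separated_translate ss.
  by exists [seq a + u | a <- s]; rewrite ?size_map//; exact: separated_translate ss.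
have [[n|] wo] := nb_infinite_clusters_nat_or_pinfty w R; rewrite wo.
  by move/nb_infinite_clusters_eq_nat: wo; rewrite !sep => /nb_infinite_clusters_eq_nat.
apply/nb_infinite_clusters_eq_pinfty => n; apply/sep.
exact: (nb_infinite_clusters_eq_pinfty w R).1.
Qed.

(** * Measurability of the number of infinite clusters *)

Section measurable_events.
Context d (T : measurableType d).

Lemma measurable_ex (I : countType) (P : I -> T -> Prop) :
  (forall i, measurable [set t | P i t]) -> measurable [set t | exists i, P i t].
Proof.
move=> mP; have -> : [set t | exists i, P i t] = \bigcup_i [set t | P i t].
  by apply/seteqP; split=> t [i]; exists i.
by apply: countable_bigcupT_measurable => //; exact: countableP.
Qed.

Lemma measurable_not (P : T -> Prop) :
  measurable [set t | P t] -> measurable [set t | ~ P t].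
Proof. exact: measurableC. Qed.

Lemma measurable_and (P Q : T -> Prop) :
  measurable [set t | P t] -> measurable [set t | Q t] ->
  measurable [set t | P t /\ Q t].
Proof. exact: measurableI. Qed.

Lemma measurable_all (I : countType) (P : I -> T -> Prop) :
  (forall i, measurable [set t | P i t]) -> measurable [set t | forall i, P i t].
Proof.
move=> mP; have -> : [set t | forall i, P i t] = [set t | ~ exists i, ~ P i t].
  by apply/seteqP; split=> t /= => [h [i]|/forallNP h i]; [exact|apply: contrapT; exact: h].
by apply/measurable_not/measurable_ex => i; exact: measurable_not.
Qed.

Lemma measurable_const (P : Prop) : measurable [set _ : T | P].
Proof.
have [p|np] := pselect P.
  by rewrite (_ : mkset _ = setT)//; apply/seteqP; split.
by rewrite (_ : mkset _ = set0)//; apply/seteqP; split.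
Qed.

Lemma measurable_guard (P : Prop) (Q : T -> Prop) :
  (P -> measurable [set t | Q t]) -> measurable [set t | P -> Q t].
Proof.
move=> mQ; have [p|np] := pselect P.
  rewrite (_ : mkset _ = [set t | Q t]); first exact: mQ.
  by apply/seteqP; split=> t //=; exact.
by rewrite (_ : mkset _ = setT)//; apply/seteqP; split=> // t _ /np.
Qed.

Lemma measurable_imply (P Q : T -> Prop) :
  measurable [set t | P t] -> measurable [set t | Q t] ->
  measurable [set t | P t -> Q t].
Proof.
move=> mP mQ; rewrite (_ : mkset _ = ~` [set t | P t] `|` [set t | Q t]).
  by apply: measurableU => //; exact: measurableC.
apply/seteqP; split=> t /= => [PQ|[nP /nP|]]//.
by have [/PQ|] := pselect (P t); [right|left].
Qed.

End measurable_events.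

(** Over a countable type this replaces infinity by countably many quantifiers. *)
Lemma infinite_setP (T : choiceType) (A : set T) :
  infinite_set A <-> forall s : seq T, exists x, A x /\ ~ (x \in s).
Proof.
split=> [iA s|h /finite_seqP[s As]].
  apply: contrapT => /forallNP Ns; apply: iA.
  apply: (@sub_finite_set _ _ [set` s]); last exact: finite_seq.
  by move=> x Ax; apply: contrapT => xs; exact: (Ns x).
by have [x [Ax]] := h s; apply; rewrite As in Ax.
Qed.

Section measurable_clusters.
Context d (T : measurableType d) (g : T -> edge_config).
Hypothesis mg : forall e : edge, measurable [set t | g t e].

Lemma measurable_open_edge a b : measurable [set t | open_edge (g t) a b].
Proof.
rewrite /open_edge; case: insub => [e|]; first exact: mg.
exact: measurable_const.
Qed.

Lemma measurable_has_path a b : measurable [set t | has_path (g t) a b].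
Proof.
apply: measurable_ex => p.
rewrite (_ : mkset _ = [set t | path (open_edge (g t)) a p /\
    (uniq (a :: p) /\ last a p = b)]); last first.
  by apply/seteqP; split=> t /= [] => [|? []].
apply: measurable_and; last exact: measurable_const.
elim: p a => [|c p IH] a /=; first exact: measurable_const.
rewrite (_ : mkset _ = [set t | open_edge (g t) a c /\ path (open_edge (g t)) c p]).
  by apply: measurable_and; [exact: measurable_open_edge|exact: IH].
by apply/seteqP; split=> t /= /andP.
Qed.

Lemma measurable_strong_cluster a b :
  measurable [set t | strong_cluster (g t) a b].
Proof. by apply: measurable_and; exact: measurable_has_path. Qed.

Lemma measurable_separated s : measurable [set t | separated (g t) s].
Proof.
rewrite (_ : mkset _ = [set t | uniq s /\
   ((forall a : vertex, a \in s -> forall r : seq vertex,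
      exists b, strong_cluster (g t) a b /\ ~ (b \in r)) /\
    (forall a b : vertex, a \in s -> b \in s -> strong_cluster (g t) a b -> a = b))]);
  last first.
  apply/seteqP; split=> t /=.
    by move=> [? i ?]; split=> //; split=> // a /i /infinite_setP.
  by move=> [? [i ?]]; split=> // a /i /infinite_setP.
apply: measurable_and; first exact: measurable_const.
apply: measurable_and; apply: measurable_all => a.
  apply: measurable_guard => _; apply: measurable_all => r.
  apply: measurable_ex => b; apply: measurable_and; last exact: measurable_const.
  exact: measurable_strong_cluster.
apply: measurable_all => b; do 2! apply: measurable_guard => _.
apply: measurable_imply; last exact: measurable_const.
exact: measurable_strong_cluster.
Qed.

Lemma measurable_nb_infinite_clusters (R : realType) (o : option nat) :
  measurable [set t | nb_infinite_clusters R (g t) =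
                      if o is Some n then n%:R%:E else +oo%E].
Proof.
have m n : measurable [set t | exists2 s, separated (g t) s & size s = n].
  rewrite (_ : mkset _ = [set t | exists s, separated (g t) s /\ size s = n]).
    apply: measurable_ex => s; apply: measurable_and; last exact: measurable_const.
    exact: measurable_separated.
  by apply/seteqP; split=> t /= [s []] => [|? ?]; exists s.
case: o => [n|].
  rewrite (_ : mkset _ = [set t | (exists2 s, separated (g t) s & size s = n) /\
      ~ (exists2 s, separated (g t) s & size s = n.+1)]).
    by apply: measurable_and => //; exact: measurable_not.
  by apply/seteqP; split=> t /= /nb_infinite_clusters_eq_nat.
rewrite (_ : mkset _ = [set t | forall n, exists2 s, separated (g t) s & size s = n]).
  exact: measurable_all.
by apply/seteqP; split=> t /= /nb_infinite_clusters_eq_pinfty.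
Qed.

End measurable_clusters.

Lemma measurable_edge (e : edge) : measurable [set w : edge_config | w e].
Proof.
apply: sub_sigma_algebra.
have -> : [set w : edge_config | w e] =
    (fun w : edge_space => w e) @^-1` [set true].
  by apply/seteqP; split.
have /continuousP : continuous (fun w : edge_space => w e).
  by move=> w; exact: (@proj_continuous _ (fun _ => bool) e w).
by apply; exact: discrete_open.
Qed.

(** * Raising a configuration *)

Lemma neighbors_sym (a b : vertex) : neighbors a b = neighbors b a.
Proof.
rewrite /neighbors !inE; apply/idP/idP => /or4P[] /eqP->;
  by rewrite ?(addrK, subrK) eqxx ?orbT.
Qed.

(** Walk along [e1], then along [e2]. *)
Lemma neighbors_walk (a b : vertex) :
  exists2 p, path neighbors a p & last a p = b.
Proof.
pose walk (x y : vertex) := exists2 p, path neighbors x p & last x p = y.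
have walk_trans x y z : walk x y -> walk y z -> walk x z.
  move=> [p pp lp] [q pq lq]; exists (p ++ q); rewrite ?cat_path ?last_cat lp//.
  by rewrite pp.
have walk1 x y : neighbors x y -> walk x y by exists [:: y] => //=; rewrite andbT.
have walk_sym x y : walk x y -> walk y x.
  move=> [p pp lp]; elim: p x pp lp => /= [x _ ->|z p IH x /andP[xz zp] lp].
    by exists [::].
  by apply: walk_trans (IH _ zp lp) (walk1 _ _ _); rewrite neighbors_sym.
have walk_line e : (forall x, neighbors x (x + e)) -> forall (m : int) x, walk x (x + e *~ m).
  move=> ne; have walkn (n : nat) x : walk x (x + e *+ n).
    elim: n => [|n IH]; first by rewrite mulr0n addr0; exists [::].
    by apply: walk_trans IH (walk1 _ _ _); rewrite mulrSr addrA.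
  move=> [n|n] x; first exact: walkn.
  apply: walk_sym; have := walkn n.+1 (x + e *~ Negz n).
  by rewrite NegzE mulrNz subrK.
have w1 : forall x, neighbors x (x + e1) by move=> x; rewrite /neighbors !inE eqxx.
have w2 : forall x, neighbors x (x + e2) by move=> x; rewrite /neighbors !inE eqxx ?orbT.
have := walk_trans _ _ _ (walk_line _ w1 (b.1 - a.1) a)
  (walk_line _ w2 (b.2 - a.2) _).
suff -> : a + e1 *~ (b.1 - a.1) + e2 *~ (b.2 - a.2) = b by [].
have pairMz (u v : int) (m : int) : ((u, v) : vertex) *~ m = (u *~ m, v *~ m).
  have pairMn n : ((u, v) : vertex) *+ n = (u *+ n, v *+ n).
    by elim: n => // n IH; rewrite !mulrS IH.
  by case: m => n; rewrite ?NegzE ?mulrNz -!pmulrn pairMn.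
rewrite /e1 /e2 !pairMz !mul0rz !intz; case: a b => [a1 a2] [b1 b2] /=.
by congr pair => /=; rewrite ?addr0 ?add0r addrC subrK.
Qed.

Section raising.
Variables (R : realType) (eps : R).
Hypothesis eps_gt0 : 0 < eps.
Implicit Types (phi psi : vertex_config R) (v a b : vertex).

Definition height phi v : R := set_val (phi v).

Lemma height_ge0 phi v : 0 <= height phi v.
Proof. by rewrite /height; have := set_valP (phi v); rewrite /= in_itv /= => /andP[]. Qed.

Lemma height_le1 phi v : height phi v <= 1.
Proof. by rewrite /height; have := set_valP (phi v); rewrite /= in_itv /= => /andP[]. Qed.

Lemma open_edge_threshold phi a b :
  open_edge (threshold_map eps phi) a b =
  neighbors a b && (height phi b < height phi a + eps).
Proof.
rewrite /open_edge; case: insubP => [e /= nab ve|/negbTE/= ->//].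
by rewrite nab /threshold_map [val e]ve.
Qed.

Lemma strong_cluster_high phi a p : path neighbors a p ->
  (forall b, b \in a :: p -> 1 - eps < height phi b) ->
  strong_cluster (threshold_map eps phi) a (last a p).
Proof.
elim: p a => [|c p IH] a /=; first by move=> _ _; exact: strong_cluster_refl.
move=> /andP[ac cp] high; apply: (@strong_cluster_trans _ c); last first.
  by apply: IH => // b bp; apply: high; rewrite in_cons bp orbT.
have ha : 1 - eps < height phi a by apply: high; rewrite mem_head.
have hc : 1 - eps < height phi c by apply: high; rewrite !in_cons eqxx orbT.
have [la lc] := (height_le1 phi a, height_le1 phi c).
split; apply/has_pathP; [exists [:: c]|exists [:: a]] => //=;
  rewrite andbT open_edge_threshold.
  by rewrite ac/=; lra.
by rewrite neighbors_sym ac/=; lra.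
Qed.

(* [G] stands for a set of configurations that have exactly [k] infinite clusters
   and that is stable under raising one value into a prescribed interval. *)
Variables (k : nat) (G : set (vertex_config R)).
Hypothesis G_nb : forall phi, G phi ->
  nb_infinite_clusters R (threshold_map eps phi) = k%:R%:E.
Hypothesis G_raise : forall phi v lo hi, G phi ->
  height phi v <= lo -> lo < hi -> hi <= 1 ->
  exists2 psi, G psi &
    (forall a, a != v -> psi a = phi a) /\ lo < height psi v < hi.

(** What is carried along a sequence of raises: the first clause preserves the
    levels already reached, the second keeps the [k] infinite clusters apart. *)
Definition raises phi psi :=
  (forall a, height phi a <= height psi a) /\
  (forall s, size s = k -> separated (threshold_map eps phi) s ->
    separated (threshold_map eps psi) s).

Lemma raises_refl phi : raises phi phi.
Proof. by []. Qed.

Lemma raises_trans phi psi chi : raises phi psi -> raises psi chi -> raises phi chi.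
Proof.
move=> [pp ps] [cp cs]; split=> [a|s ks /ps - /(_ ks)]; last exact: cs.
exact: le_trans (cp a).
Qed.

(** The new value [y] is taken in the interval from [c] to [c + eps / 2]: then
    [y < height phi b + eps] for each neighbor [b], so that raising opens edges
    only, and [separated_merging] applies at [v]. *)
Lemma raise_vertex phi v c : G phi -> c < 1 ->
  (forall b, neighbors v b -> c - eps / 2 < height phi b) ->
  exists psi, [/\ G psi, raises phi psi & c < height psi v].
Proof.
move=> Gphi c1 nv; have [cv|vc] := ltP c (height phi v).
  by exists phi; split=> //; exact: raises_refl.
have [psi Gpsi [off /andP[lo hi]]] :
    exists2 psi, G psi & (forall a, a != v -> psi a = phi a) /\
      c < height psi v < Num.min 1 (c + eps / 2).
  by apply: G_raise => //; rewrite ?lt_min ?ge_min ?c1 ?lexx//= ltrDl divr_gt0.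
have {}hi : height psi v < c + eps / 2 by move: hi; rewrite lt_min => /andP[].
have offh a : a != v -> height psi a = height phi a by move=> /off; rewrite /height => ->.
have up a : height phi a <= height psi a.
  by have [->|/offh->//] := eqVneq a v; lra.
exists psi; split=> //; split=> // s ks.
have /nb_infinite_clusters_eq_nat[_ Nk] := G_nb Gphi.
have /nb_infinite_clusters_eq_nat[Ek _] := G_nb Gpsi.
apply: (@separated_merging _ _ v); rewrite ?ks// => a b.
  rewrite !open_edge_threshold => /andP[ab /= h]; rewrite ab/=.
  have [bv|bv] := eqVneq b v.
    subst b; have /= := nv a; rewrite neighbors_sym ab => /(_ isT).
    by have := up a; lra.
  by rewrite (offh b)//; have := up a; lra.
move=> av bv; rewrite !open_edge_threshold => /andP[ab /= h].
by rewrite ab -!offh.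
Qed.

Lemma raise_vertices phi (S : seq vertex) c : G phi -> c < 1 ->
  (forall v b, v \in S -> neighbors v b -> c - eps / 2 < height phi b) ->
  exists psi, [/\ G psi, raises phi psi & forall v, v \in S -> c < height psi v].
Proof.
elim: S phi => [|v S IH] phi Gphi c1 nS.
  by exists phi; split=> //; exact: raises_refl.
have [psi [Gpsi Rpsi Spsi]] : exists psi, [/\ G psi, raises phi psi &
    forall v, v \in S -> c < height psi v].
  by apply: IH => // x b xS; apply: nS; rewrite in_cons xS orbT.
have [chi [Gchi Rchi vchi]] : exists chi, [/\ G chi, raises psi chi &
    c < height chi v].
  apply: raise_vertex => // b vb; apply: (lt_le_trans _ (Rpsi.1 b)).
  by apply: nS vb; rewrite mem_head.
exists chi; split=> //; first exact: raises_trans Rchi.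
move=> x; rewrite in_cons => /predU1P[->//|xS].
exact: lt_le_trans (Spsi _ xS) (Rchi.1 x).
Qed.

(** One level costs [eps / 2]: the neighbors of [S] are first brought above
    [c - eps / 2], then the members of [S] are raised one after the other. *)
Lemma raise_to_level (n : nat) phi (S : seq vertex) c : G phi -> c < 1 ->
  c < n%:R * (eps / 2) ->
  exists psi, [/\ G psi, raises phi psi & forall v, v \in S -> c < height psi v].
Proof.
elim: n phi S c => [|n IH] phi S c Gphi c1.
  rewrite mul0r => c0; exists phi; split=> //.
  by move=> v _; exact: lt_le_trans (height_ge0 _ _).
move=> cn.
pose S' := flatten [seq [:: v + e1; v - e1; v + e2; v - e2] | v <- S].
have [psi [Gpsi Rpsi Spsi]] : exists psi, [/\ G psi, raises phi psi &
    forall v, v \in S' -> c - eps / 2 < height psi v].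
  apply: IH => //; have := eps_gt0; first lra.
  by move: cn; rewrite -natr1 mulrDl mul1r; lra.
have [chi [Gchi Rchi Schi]] : exists chi, [/\ G chi, raises psi chi &
    forall v, v \in S -> c < height chi v].
  apply: raise_vertices => // v b vS vb; apply: Spsi.
  by apply/flattenP; exists [:: v + e1; v - e1; v + e2; v - e2] => //; apply/mapP; exists v.
by exists chi; split=> //; exact: raises_trans Rchi.
Qed.

(** Once a walk joining two of the [k] infinite clusters lies above [1 - eps],
    its edges are open in both directions and the two clusters coincide, although
    the raises have kept them apart. *)
Lemma finite_number_le1 phi : G phi -> (k <= 1)%N.
Proof.
move=> Gphi; rewrite leqNgt; apply/negP => k1.
have /nb_infinite_clusters_eq_nat[[s ss ks] _] := G_nb Gphi.
case: s ss ks => [|a [|b s]] ss ks; [by rewrite -ks in k1|by rewrite -ks in k1|].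
have [p pp lp] := neighbors_walk a b.
pose n := Num.bound (2 / eps).
have [psi [Gpsi [_ Rpsi] high]] : exists psi, [/\ G psi, raises phi psi &
    forall v, v \in a :: p -> 1 - eps < height psi v].
  apply: (@raise_to_level n) => //; first by have := eps_gt0; lra.
  have : 2 / eps < n%:R by apply: archi_boundP; rewrite divr_ge0// ltW.
  by rewrite ltr_pdivrMr//; have := eps_gt0; lra.
have [u _ d] := Rpsi _ ks ss.
have ab : a = b.
  apply: d; rewrite ?inE ?eqxx ?orbT// -lp.
  exact: strong_cluster_high.
by move: u; rewrite /= ab mem_head.
Qed.

End raising.

(** * Cylinders generate the Borel sets *)

Section cylinders.
Variable R : realType.
Local Notation V := (vertex_config R).
Implicit Types (phi : V) (s : seq vertex) (A B : vertex -> set R).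

Definition cylinder s A : set V := [set phi | forall a, a \in s -> A a (height phi a)].

Definition cylinders : set (set V) :=
  [set C | exists s A, (forall a, measurable (A a)) /\ C = cylinder s A].

Lemma height_continuous a : continuous (fun phi : vertex_space R => height phi a).
Proof.
move=> phi; apply: (@continuous_comp (vertex_space R) (unit_interval R) R
  (fun phi => phi a) set_val); last exact: initial_continuous.
exact: (@proj_continuous _ (fun _ => unit_interval R) a phi).
Qed.

Lemma measurable_height a : measurable_fun setT (fun phi : V => height phi a).
Proof.
apply: (measurability _ (RGenOpens.measurableE R)).
move=> _ [_ [p [q ->] <-]]; rewrite setTI; apply: sub_sigma_algebra.
have /continuousP := @height_continuous a; apply; exact: interval_open.
Qed.

Lemma cylinder_nil A : cylinder [::] A = setT.
Proof. by apply/seteqP; split. Qed.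

Lemma cylinder_cons a s A :
  cylinder (a :: s) A = (fun phi => height phi a) @^-1` A a `&` cylinder s A.
Proof.
apply/seteqP; split=> phi /=.
  move=> h; split=> [|b bs]; first by apply: h; rewrite mem_head.
  by apply: h; rewrite in_cons bs orbT.
by move=> [h1 h2] b; rewrite in_cons => /predU1P[->//|]; exact: h2.
Qed.

Lemma measurable_cylinder s A : (forall a, measurable (A a)) -> measurable (cylinder s A).
Proof.
move=> mA; elim: s => [|a s IH]; first by rewrite cylinder_nil.
rewrite cylinder_cons; apply: measurableI => //.
by rewrite -[X in measurable X]setTI; exact: measurable_height.
Qed.

Lemma cylinders_measurable : cylinders `<=` measurable.
Proof. by move=> _ [s [A [mA ->]]]; exact: measurable_cylinder. Qed.

Lemma cylindersT : cylinders setT.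
Proof. by exists [::], (fun=> setT); rewrite cylinder_nil. Qed.

Lemma cylinder_cat s t A B : cylinder s A `&` cylinder t B =
  cylinder (s ++ t) (fun a => (if a \in s then A a else setT) `&`
                              (if a \in t then B a else setT)).
Proof.
apply/seteqP; split=> phi /=.
  by move=> [hA hB] a _; split; case: ifPn => // h; [exact: hA|exact: hB].
by move=> h; split=> a ha; have : a \in s ++ t by [rewrite mem_cat ha ?orbT];
  move=> /h; rewrite ha => -[].
Qed.

Lemma cylinders_setI : setI_closed cylinders.
Proof.
move=> _ _ [s [A [mA ->]]] [t [B [mB ->]]]; rewrite cylinder_cat.
by do 2! eexists; split; last reflexivity; move=> a /=;
  apply: measurableI; case: ifP.
Qed.

(* Boxes with rational sides are countably many and form a base of the product
   topology. *)
Let box (r : seq (vertex * (rat * rat))) : set V :=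
  [set phi | forall x, x \in r -> ratr x.2.1 < height phi x.1 < ratr x.2.2].

Lemma box_nbhs (phi : V) (O : set (vertex_space R)) : nbhs (phi : vertex_space R) O ->
  exists2 r, box r phi & box r `<=` O.
Proof.
pose F : set_system (vertex_space R) := [set A : set V | exists2 r, box r phi & box r `<=` A].
have FF : Filter F.
  split; first by exists [::].
    move=> A B [r rp rA] [t tp tB]; exists (r ++ t).
      by move=> x; rewrite mem_cat => /orP[/rp|/tp].
    by move=> psi h; split; [apply: rA|apply: tB] => x hx; apply: h;
      rewrite mem_cat hx ?orbT.
  by move=> A B AB [r rp rA]; exists r => //; exact: subset_trans AB.
(* a filter converges in the product as soon as its images under the coordinate
   maps converge *)
suff : F --> (phi : vertex_space R) by apply.
apply/cvg_sup => a A; rewrite nbhsE /= => -[_ [[U oU <-] /= Uphi] UA].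
case: oU Uphi UA => W oW <- /= Wphi UA.
move: oW; rewrite openE => /(_ _ Wphi); rewrite /interior /= -nbhs_ballE.
move=> [e /= e0 eW].
have [p _ /andP[p1 p2]] : exists2 p : rat, true & height phi a - e < ratr p < height phi a.
  by have [p] := @rat_in_itvoo R (height phi a - e) (height phi a)
    ltac:(by rewrite ltrBlDr ltrDl); rewrite in_itv /= => h; exists p.
have [q _ /andP[q1 q2]] : exists2 q : rat, true & height phi a < ratr q < height phi a + e.
  by have [q] := @rat_in_itvoo R (height phi a) (height phi a + e)
    ltac:(by rewrite ltrDl); rewrite in_itv /= => h; exists q.
exists [:: (a, (p, q))].
  by move=> x; rewrite inE => /eqP->; rewrite p2 q1.
move=> psi /(_ (a, (p, q)) (mem_head _ _)) /= /andP[h1 h2].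
apply: UA => /=; apply: eW; rewrite /ball /= ltr_distl /=.
by rewrite -/(height psi a) -/(height phi a); apply/andP; split; lra.
Qed.

Lemma measurable_box r : <<s cylinders >> (box r).
Proof.
elim: r => [|[a [p q]] r IH].
  rewrite (_ : box _ = setT); last by apply/seteqP; split.
  by apply: sub_sigma_algebra; exact: cylindersT.
rewrite (_ : box _ = cylinder [:: a] (fun=> [set` `]ratr p, ratr q[]) `&` box r).
  apply: (@measurableI _ (g_sigma_algebraType cylinders)) => //.
  by apply: sub_sigma_algebra; exists [:: a], (fun=> [set` `]ratr p, ratr q[]).
apply/seteqP; split=> phi /=.
  move=> h; split.
    by move=> b; rewrite inE => /eqP->; rewrite /= in_itv /=; have := h _ (mem_head _ _).
  by move=> x xr; apply: h; rewrite in_cons xr orbT.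
move=> [h1 h2] x; rewrite in_cons => /predU1P[->/=|]; last exact: h2.
by have := h1 a (mem_head _ _); rewrite /= in_itv.
Qed.

(** An open set is the union of the rational boxes that it contains, and these
    are countably many. *)
Lemma measurable_vertex_configE : @measurable _ V = <<s cylinders >>.
Proof.
apply/seteqP; split; last first.
  apply: smallest_sub; first exact: sigma_algebra_measurable.
  exact: cylinders_measurable.
apply: smallest_sub.
  exact: (@sigma_algebra_measurable _ (g_sigma_algebraType cylinders)).
move=> O oO; have -> : O = \bigcup_(r in [set r | box r `<=` O]) box r.
  apply/seteqP; split=> [phi Ophi|phi [r rO]]; last exact: rO.
  have [r] : exists2 r, box r phi & box r `<=` O.
    by apply: box_nbhs; move: oO; rewrite openE; exact.
  by exists r.
rewrite bigcup_mkcond.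
apply: (@countable_bigcupT_measurable _ (g_sigma_algebraType cylinders)).
  exact: countableP.
by move=> r; case: ifP => _; [exact: measurable_box|exact: measurable0].
Qed.

End cylinders.

(** * Rotations of the unit interval *)

Section rotation.
Variable R : realType.
Implicit Types (r x : R) (A : set R).

Lemma measurable_fun_translate r :
  measurable_fun setT (fun x : measurableTypeR R => x + r : measurableTypeR R).
Proof.
exact: (measurable_funD (@measurable_id _ (measurableTypeR R) setT)
  (@measurable_cst _ _ (measurableTypeR R) (measurableTypeR R) setT r)).
Qed.

Lemma measurable_translate r A : measurable A -> measurable [set x | A (x + r)].
Proof.
move=> mA; rewrite -[X in measurable X]setTI.
exact: measurable_fun_translate.
Qed.

Lemma lebesgue_measure_translate r A : measurable A ->
  lebesgue_measure [set x | A (x + r)] = lebesgue_measure A.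
Proof.
move=> mA; pose f (x : R) : measurableTypeR R := x + r.
have mf : measurable_fun setT f.
  exact: measurable_fun_translate.
rewrite -[LHS]/(pushforward lebesgue_measure f A).
apply/esym/(@lebesgue_measure_unique _ (pushforward lebesgue_measure f)) => //= _ [[a b]] _ <-.
rewrite /pushforward (_ : f @^-1` _ = `](a - r), (b - r)]%classic); last first.
  by apply/seteqP; split=> x /=; rewrite !in_itv /= /f ltrBlDr lerBrDr.
rewrite !lebesgue_measure_itv /= !lte_fin ltrD2r; case: ifP => // _.
by rewrite -!EFinB; congr (_%:E); lra.
Qed.

(** The point 1 is kept fixed, which makes the rotation a bijection of the
    closed unit interval when the angle lies in it. *)
Definition rotate r x : R :=
  if x == 1 then 1 else if x + r < 1 then x + r else x + r - 1.

Lemma rotate_itv r x : 0 <= r <= 1 -> x \in `[0, 1] -> rotate r x \in `[0, 1].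
Proof.
rewrite /rotate !in_itv /= => /andP[r0 r1] /andP[x0 x1].
have [_|xn1] := eqVneq x 1; first by rewrite ler01 lexx.
have {xn1}xl1 : x < 1 by rewrite lt_neqAle xn1.
by have [xr|xr] := ltP (x + r) 1; apply/andP; split; lra.
Qed.

Lemma rotate_preimageE r A : 0 <= r <= 1 ->
  rotate r @^-1` A `&` `[0, 1] =
  [set x | (A `&` `[r, 1[) (x + r)] `|` [set x | (A `&` `[0, r[) (x + (r - 1))]
  `|` (A `&` [set 1]).
Proof.
move=> /andP[r0 r1]; apply/seteqP; split=> x /=; rewrite !in_itv /=.
  move=> [Ax /andP[x0 x1]]; move: Ax; rewrite /rotate.
  have [->|xn1] := eqVneq x 1; first by right.
  have {xn1}xl1 : x < 1 by rewrite lt_neqAle xn1.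
  left; move: Ax; case: (ltP (x + r) 1) => xr Ax; [left|right].
    by split=> //; apply/andP; split; lra.
  by rewrite addrA; split=> //; apply/andP; split; lra.
rewrite /rotate => -[[[Ax /andP[h1 h2]]|[Ax /andP[h1 h2]]]|[Ax xE]].
- have -> : (x == 1) = false by apply/eqP; lra.
  by rewrite h2; split=> //; apply/andP; split; lra.
- have -> : (x == 1) = false by apply/eqP; lra.
  have -> : (x + r < 1) = false by apply/negbTE; rewrite -leNgt; lra.
  by rewrite -addrA; split=> //; apply/andP; split; lra.
- by subst x; rewrite eqxx ler01 lexx.
Qed.

(** The rotation translates [0, 1 - r[ onto [r, 1[ and [1 - r, 1[ onto [0, r[, and
    Lebesgue measure is invariant under translations. *)
Lemma lebesgue_measure_rotate r A : 0 <= r <= 1 -> measurable A ->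
  lebesgue_measure (rotate r @^-1` A `&` `[0, 1]) =
  lebesgue_measure (A `&` `[0, 1]).
Proof.
move=> r01 mA; have /andP[r0 r1] := r01.
have mAr : measurable (A `&` `[r, 1[) by exact: measurableI.
have mA0 : measurable (A `&` `[0, r[) by exact: measurableI.
have mA1 : measurable (A `&` [set 1]) by exact: measurableI.
have -> : A `&` `[0, 1] = (A `&` `[r, 1[) `|` (A `&` `[0, r[) `|` (A `&` [set 1]).
  apply/seteqP; split=> x /=; rewrite !in_itv /=.
    move=> [Ax /andP[x0 x1]].
    have [xr|xr] := ltP x r; first by left; right; rewrite x0.
    have [xE|xn1] := eqVneq x 1; first by right.
    by left; left; rewrite lt_neqAle xn1 x1.
  move=> [[[Ax /andP[h1 h2]]|[Ax /andP[h1 h2]]]|[Ax xE]]; split=> //; last by rewrite xE ler01 lexx.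
    by apply/andP; split; lra.
  by apply/andP; split; lra.
rewrite rotate_preimageE//.
have mtr : measurable [set x | (A `&` `[r, 1[) (x + r)] by exact: measurable_translate.
have mt0 : measurable [set x | (A `&` `[0, r[) (x + (r - 1))] by exact: measurable_translate.
have disj (X Y : set R) : (forall x, X x -> Y x -> False) -> X `&` Y = set0.
  by move=> XY; apply/seteqP; split=> // x [Xx Yx]; have := XY x Xx Yx.
rewrite measureU//; last 2 first.
  - exact: measurableU.
  - apply: disj => x /= + [_ xE]; rewrite !in_itv /= => -[[_ /andP[h1 h2]]|[_ /andP[h1 h2]]]; lra.
rewrite measureU//; last first.
  by apply: disj => x /=; rewrite !in_itv /= => -[_ /andP[h1 h2]] [_ /andP[h3 h4]]; lra.
rewrite [RHS]measureU//; last 2 first.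
  - exact: measurableU.
  - apply: disj => x /= + [_ xE]; rewrite !in_itv /= => -[[_ /andP[h1 h2]]|[_ /andP[h1 h2]]]; lra.
rewrite [in RHS]measureU//; last first.
  by apply: disj => x /=; rewrite !in_itv /= => -[_ /andP[h1 h2]] [_ /andP[h3 h4]]; lra.
congr (_ + _ + _)%E; first exact: (lebesgue_measure_translate r mAr).
exact: (lebesgue_measure_translate (r - 1) mA0).
Qed.

Lemma measurable_rotate r A : measurable A -> measurable (rotate r @^-1` A).
Proof.
move=> mA; rewrite (_ : _ @^-1` _ = (if 1 \in A then [set 1] else set0) `|`
  (~` [set 1] `&` (([set x | A (x + r)] `&` [set x | (x + r < 1)%R]) `|`
     ([set x | A (x + (r - 1))] `&` ~` [set x | (x + r < 1)%R])))).
  apply: measurableU; first by case: ifP.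
  apply: measurableI; first exact: measurableC.
  have m1 : measurable [set x | x + r < 1].
    have := @measurable_translate r `]-oo, 1[%classic (measurable_itv _).
    by congr measurable; apply/seteqP; split=> x /=; rewrite in_itv.
  by apply: measurableU; apply: measurableI => //; try (exact: measurable_translate);
    exact: measurableC.
apply/seteqP; split=> x /=; rewrite /rotate.
  have [->|xn1] := eqVneq x 1.
    by move=> A1; left; rewrite mem_set.
  move=> Ax; right; split; first exact/eqP.
  move: Ax; case: ifP => xr Ax; first by left.
  by right; rewrite addrA.
have [->|xn1] := eqVneq x 1.
  by case; [case: ifPn => // /set_mem|move=> []].
case; first by case: ifP => // _ /= /eqP; rewrite (negbTE xn1).
by move=> [_ [[Ax ->]//|[Ax /negP/negbTE ->]]]; rewrite -addrA.
Qed.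

End rotation.

(** * Measure-preserving maps of the configuration space *)

Section product_measure.
Variables (R : realType) (lambda : probability (vertex_config R) R).
Hypothesis hlambda : lebesgue_product_measure lambda.
Local Notation V := (vertex_config R).
Local Notation leb01 A := (lebesgue_measure (A `&` `[0%R : R, 1%R]%classic)).

Lemma measure_cylinder (s : seq vertex) (A : vertex -> set R) :
  uniq s -> (forall a, measurable (A a)) ->
  lambda (cylinder s A) = (\prod_(a <- s) leb01 (A a))%E.
Proof. exact: hlambda. Qed.

Lemma cylinder_undup (s : seq vertex) (A : vertex -> set R) :
  cylinder s A = cylinder (undup s) A.
Proof. by apply/seteqP; split=> phi h a; move: (h a); rewrite mem_undup. Qed.

Lemma eq_measure_cylinders (m1 m2 : {measure set V -> \bar R}) :
  (forall C, @cylinders R C -> m1 C = m2 C) -> (m1 setT < +oo)%E ->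
  forall C, measurable C -> m1 C = m2 C.
Proof.
move=> m12 m1oo C; rewrite measurable_vertex_configE.
apply: (@g_sigma_algebra_measure_unique _ _ _ (@cylinders R)
  (@cylinders_measurable R) (fun=> setT)) => //.
- by move=> _; exact: cylindersT.
- by rewrite bigcup_const//; exists 0%N.
- exact: cylinders_setI.
Qed.

Definition preserves (T : V -> V) :=
  forall C, measurable C -> measurable (T @^-1` C) /\ lambda (T @^-1` C) = lambda C.

Lemma preserves_cylinders (T : V -> V) :
  (forall s A, uniq s -> (forall a, measurable (A a)) ->
    exists s' A', [/\ uniq s', forall a, measurable (A' a),
      T @^-1` cylinder s A = cylinder s' A' &
      (\prod_(a <- s') leb01 (A' a) = \prod_(a <- s) leb01 (A a))%E]) ->
  preserves T.
Proof.
move=> TE.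
have mT : measurable_fun setT T.
  apply: (measurability _ (measurable_vertex_configE R)).
  move=> _ [_ [s [A [mA ->]]] <-]; rewrite setTI cylinder_undup.
  have [s' [A' [_ mA' -> _]]] := TE _ _ (undup_uniq s) mA.
  exact: measurable_cylinder.
move=> C mC; split; first by rewrite -[X in measurable X]setTI; exact: mT.
rewrite -[LHS]/(pushforward lambda T C).
apply: (eq_measure_cylinders (m1 := pushforward lambda T)) => //.
  move=> _ [s [A [mA ->]]]; rewrite cylinder_undup.
  have [s' [A' [us' mA' TE' pE]]] := TE _ _ (undup_uniq s) mA.
  by rewrite /= /pushforward TE' !measure_cylinder ?undup_uniq.
by rewrite /= /pushforward preimage_setT probability_setT ltry.
Qed.

Definition shift (n : nat) (phi : V) : V := fun a => phi (a + (n%:Z, 0)).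

Lemma shift_cylinder n s A :
  shift n @^-1` cylinder s A =
  cylinder [seq a + (n%:Z, 0) | a <- s] (fun a => A (a - (n%:Z, 0))).
Proof.
apply/seteqP; split=> phi h a.
  by move=> /mapP[b bs ->]; rewrite addrK; exact: h.
move=> sa; have := h (a + (n%:Z, 0)); rewrite addrK; apply.
exact: map_f.
Qed.

Lemma shift_preserves n : preserves (shift n).
Proof.
apply: preserves_cylinders => s A us mA; rewrite shift_cylinder.
do 2! eexists; split; last 2 first.
- reflexivity.
- by rewrite big_map; apply: eq_bigr => a _; rewrite addrK.
- by rewrite map_inj_uniq//; exact: addIr.
- by move=> a; exact: mA.
Qed.

Definition rotate_at (v : vertex) (r : R) (phi : V) : V :=
  fun a => if a == v then insubd (phi a) (rotate r (height phi a)) else phi a.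

Lemma height_rotate_at v r phi a : 0 <= r <= 1 ->
  height (rotate_at v r phi) a =
  if a == v then rotate r (height phi a) else height phi a.
Proof.
move=> r01; rewrite /height /rotate_at; case: eqP => // _.
rewrite [LHS]val_insubd.
suff -> : rotate r (height phi a) \in [set` `[0 : R, 1 : R]] by [].
by rewrite inE /=; apply: rotate_itv => //; rewrite in_itv /= height_ge0 height_le1.
Qed.

Lemma rotate_at_preserves v r : 0 <= r <= 1 -> preserves (rotate_at v r).
Proof.
move=> r01; apply: preserves_cylinders => s A us mA.
exists s, (fun a => if a == v then rotate r @^-1` A a else A a); split=> //.
- by move=> a; case: eqP => // _; exact: measurable_rotate.
- apply/seteqP; split=> phi h a /h; rewrite height_rotate_at//; by case: ifP.
- apply: eq_bigr => a _; case: ifP => // _; exact: lebesgue_measure_rotate.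
Qed.

(** * The zero-one law for translation-invariant events *)

Let P (X : set V) : R := fine (lambda X).

Let PE X : measurable X -> lambda X = (P X)%:E.
Proof. by move=> mX; rewrite /P fineK// fin_num_measure. Qed.

Let P_D X Y : measurable X -> measurable Y -> Y `<=` X -> P (X `\` Y) = P X - P Y.
Proof.
move=> mX mY YX; apply: EFin_inj; rewrite EFinB -!PE//; last exact: measurableD.
rewrite measureD//; first by rewrite setIidr.
exact: (le_lt_trans (probability_le1 lambda mX) (ltry _)).
Qed.

Let P_le X Y : measurable X -> measurable Y -> Y `<=` X -> P Y <= P X.
Proof. by move=> mX mY YX; rewrite -lee_fin -!PE//; apply: le_measure; rewrite ?inE. Qed.

Let P_ge0 X : 0 <= P X.
Proof. by rewrite fine_ge0. Qed.

Let P_le1 X : measurable X -> P X <= 1.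
Proof. by move=> mX; rewrite -lee_fin -PE//; exact: probability_le1. Qed.

Lemma shift_apart (s t : seq vertex) : exists N, forall n, (N <= n)%N ->
  forall a b : vertex, a \in s -> b \in t -> a <> b + (n%:Z, 0).
Proof.
pose L := [seq `|a.1 - b.1|%N | a <- s, b <- t].
exists (\max_(x <- L) x).+1 => n Nn a b sa tb abn.
have : (`|a.1 - b.1| <= \max_(x <- L) x)%N.
  by apply: leq_bigmax_seq => //; apply/allpairsP; exists (a, b).
rewrite abn /= addrC addKr absz_nat => nN.
by move: Nn; rewrite ltnNge nN.
Qed.

(** For a cylinder [C] the two events depend on disjoint sets of coordinates as
    soon as [n] is large, hence are independent.  The sets [C] that satisfy the
    conclusion form a lambda-system, so the pi-lambda theorem gives the rest. *)
Lemma mixing C B : measurable C -> @cylinders R B -> forall e : R, 0 < e ->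
  exists N, forall n, (N <= n)%N ->
    `|P (C `&` shift n @^-1` B) - P C * P B| <= e.
Proof.
move=> mC [t [B' [mB' BE]]].
have mB : measurable B by rewrite BE; exact: measurable_cylinder.
have mS n : measurable (shift n @^-1` B) by have [] := shift_preserves n mB.
have PS n : P (shift n @^-1` B) = P B by rewrite /P; have [_ ->] := shift_preserves n mB.
pose H := [set C | measurable C /\ forall e : R, 0 < e ->
  exists N, forall n, (N <= n)%N -> `|P (C `&` shift n @^-1` B) - P C * P B| <= e].
suff : <<s @cylinders R >> `<=` H by rewrite -measurable_vertex_configE => /(_ _ mC)[].
apply: lambda_system_subset; [exact: cylinders_setI| |move=> {mC}C|by []]; last first.
  move=> [s [A [mA ->]]]; split; first exact: measurable_cylinder.
  move=> e e0; have [N hN] := shift_apart (undup s) (undup t).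
  exists N => n /hN apart.
  suff -> : P (cylinder s A `&` shift n @^-1` B) = P (cylinder s A) * P B.
    by rewrite subrr normr0 ltW.
  apply: EFin_inj; rewrite EFinM -!PE//; [|exact: measurable_cylinder|
    by apply: measurableI => //; exact: measurable_cylinder].
  rewrite BE (cylinder_undup s) (cylinder_undup t) shift_cylinder cylinder_cat.
  rewrite !measure_cylinder ?undup_uniq//; last 2 first.
  - rewrite cat_uniq undup_uniq map_inj_uniq ?undup_uniq; last exact: addIr.
    rewrite andbT; apply/hasPn => _ /mapP[b bt ->]; apply/negP => bs.
    exact: apart bs bt erefl.
  - by move=> a; apply: measurableI; case: ifP.
  rewrite big_cat big_map /=; congr (_ * _)%E; rewrite !big_seq.
    apply: eq_bigr => a sa; rewrite sa; case: ifP => [/mapP[b bt ab]|]; last by rewrite setIT.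
    by have := apart _ _ sa bt ab.
  apply: eq_bigr => b bt; rewrite /= addrK (map_f (fun a : vertex => a + (n%:Z, 0)) bt).
  case: ifP => [bs|]; last by rewrite setTI.
  by have := apart _ _ bs bt.
split.
- by [].
- split=> // e e0; exists 0%N => n _; rewrite setTI PS {2}/P probability_setT mul1r subrr normr0.
  exact: ltW.
- move=> X Y YX [mX hX] [mY hY]; split; first exact: measurableD.
  move=> e e0; have e2 : 0 < e / 2 by rewrite divr_gt0.
  have [N1 h1] := hX _ e2; have [N2 h2] := hY _ e2.
  exists (maxn N1 N2) => n; rewrite geq_max => /andP[/h1 {}h1 /h2 {}h2].
  have -> : (X `\` Y) `&` shift n @^-1` B =
      (X `&` shift n @^-1` B) `\` (Y `&` shift n @^-1` B).
    apply/seteqP; split=> x /=; first by move=> [[Xx nYx] Sx]; split=> // -[].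
    by move=> [[Xx Sx] h]; split=> //; split=> // Yx; exact: h.
  rewrite !P_D//; [|exact: measurableI|exact: measurableI|exact: setSI].
  move: h1 h2; rewrite mulrBl !ler_norml => /andP[? ?] /andP[? ?].
  by apply/andP; split; lra.
(* replacing the union by [F i] costs at most [lambda (U `\` F i)] in both
   terms, uniformly in [n] *)
- move=> F ndF hF; have mF i : measurable (F i) by have [] := hF i.
  have mUF : measurable (\bigcup_i F i) by exact: bigcupT_measurable.
  split=> // e e0; have e3 : 0 < e / 3 by rewrite divr_gt0.
  have [i Fi] : exists i, P (\bigcup_i F i `\` F i) <= e / 3.
    have : lambda (F i) @[i --> \oo] --> (P (\bigcup_i F i))%:E.
      by rewrite -PE//; exact: nondecreasing_cvg_mu.
    move=> /fine_cvgP[_ /cvgrPdist_le /(_ _ e3)[i _ /(_ i (leqnn i))]] /=.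
    move=> h; exists i; rewrite P_D//; last exact: bigcup_sup.
    by apply: le_trans h; exact: ler_norm.
  have [N hN] := (hF i).2 _ e3; exists N => n /hN {}hN.
  set U := \bigcup_i F i in mUF Fi *.
  have FU : F i `<=` U by exact: bigcup_sup.
  have mD : measurable (U `\` F i) by exact: measurableD.
  have d1 : P U - P (F i) <= e / 3 by rewrite -P_D.
  have d0 : 0 <= P U - P (F i) by rewrite subr_ge0; exact: P_le.
  have c1 : P (U `&` shift n @^-1` B) - P (F i `&` shift n @^-1` B) <= e / 3.
    rewrite -P_D; [|exact: measurableI|exact: measurableI|exact: setSI].
    apply: le_trans Fi; apply: P_le => //.
      by apply: measurableD; exact: measurableI.
    by move=> x [[Ux Sx] h]; split=> // Fx; exact: h.
  have c0 : 0 <= P (U `&` shift n @^-1` B) - P (F i `&` shift n @^-1` B).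
    by rewrite subr_ge0; apply: P_le; [exact: measurableI|exact: measurableI|exact: setSI].
  have b0 := P_ge0 B; have b1 := P_le1 mB.
  have m0 : 0 <= (P U - P (F i)) * P B by exact: mulr_ge0.
  have m1 : (P U - P (F i)) * P B <= e / 3.
    by apply: le_trans d1; rewrite ler_piMr.
  rewrite mulrBl in m0 m1.
  by move: hN; rewrite !ler_norml => /andP[l1 l2]; apply/andP; split; lra.
Qed.

(** If [A] is invariant then [A `&` B] and [A `&` shift n @^-1` B] have the same
    probability, so that letting [n] grow makes [A] independent of every
    cylinder [B], hence of every event, itself included. *)
Lemma zero_one_law A : measurable A -> (forall n, shift n @^-1` A = A) ->
  lambda A = 0%E \/ lambda A = 1%E.
Proof.
move=> mA SA.
have indep B : @cylinders R B -> P (B `&` A) = P A * P B.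
  move=> cB; have mB := cylinders_measurable cB.
  apply/eqP; rewrite -subr_eq0 -normr_le0; apply/ler_addgt0Pr => e e0; rewrite add0r.
  have [N /(_ N (leqnn N))] := mixing mA cB e0.
  suff -> : P (A `&` shift N @^-1` B) = P (B `&` A) by [].
  have -> : A `&` shift N @^-1` B = shift N @^-1` (B `&` A).
    by rewrite preimage_setI SA setIC.
  rewrite /P; by have [_ ->] := shift_preserves N (measurableI _ _ mB mA).
have indepA : mrestr lambda mA A = mscale (NngNum (P_ge0 A)) lambda A.
  apply: (eq_measure_cylinders (m1 := mrestr lambda mA)
    (m2 := mscale (NngNum (P_ge0 A)) lambda)) => //.
    move=> B cB; have mB := cylinders_measurable cB.
    rewrite /= /mrestr /mscale /= !PE//; last exact: measurableI.
    by rewrite -EFinM indep.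
  by rewrite /= /mrestr setTI PE// ltry.
move: indepA; rewrite /mrestr /mscale /= setIid PE// -EFinM => -[PA].
have /eqP : P A * (P A - 1) = 0 by rewrite mulrBr mulr1 -PA subrr.
rewrite mulf_eq0 subr_eq0 => /orP[] /eqP ->; by [left|right].
Qed.

End product_measure.

(** * The almost sure number of infinite clusters *)

Lemma exists_outside_null d (T : measurableType d) (R : realType)
    (mu : probability T R) (I : countType) (F : I -> set T) :
  (forall i, measurable (F i) /\ mu (F i) = 0%E) -> exists t, forall i, ~ F i t.
Proof.
move=> F0; apply: contrapT => /forallNP nF.
pose G n := if unpickle n is Some i then F i else set0.
have negG n : mu.-negligible (G n).
  rewrite /G; case: unpickle => [i|]; last exact: negligible_set0.
  by have [mF Fi0] := F0 i; exact/negligibleP.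
have : mu.-negligible setT.
  apply: negligibleS (negligible_bigcup negG) => t _.
  have [i Fit] : exists i, F i t by apply: contrapT => /forallNP; exact: nF.
  by exists (pickle i) => //; rewrite /G pickleK.
move/negligibleP => /(_ measurableT) mu0.
have /eqP : 1%E = 0%E :> \bar R by rewrite -(probability_setT mu); exact: mu0.
by rewrite onee_eq0.
Qed.

Section almost_sure_number.
Variables (R : realType) (lambda : probability (vertex_config R) R).
Hypothesis hlambda : lebesgue_product_measure lambda.
Variable eps : R.
Hypothesis eps_gt0 : 0 < eps.
Local Notation V := (vertex_config R).

Lemma measurable_threshold (e : edge) : measurable [set phi : V | threshold_map eps phi e].
Proof.
rewrite (_ : mkset _ = setT `&` (fun phi : V =>
    height phi (val e).2 < height phi (val e).1 + eps) @^-1` [set true]); last first.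
  by rewrite setTI; apply/seteqP; split.
have m : measurable_fun setT (fun phi : V =>
    height phi (val e).2 < height phi (val e).1 + eps).
  apply: measurable_fun_ltr; first exact: measurable_height.
  by apply: measurable_funD => //; exact: measurable_height.
exact: m.
Qed.

Let nb_event (o : option nat) : set V :=
  [set phi | nb_infinite_clusters R (threshold_map eps phi) =
             if o is Some n then n%:R%:E else +oo%E].

Let measurable_nb_event o : measurable (nb_event o).
Proof. exact: measurable_nb_infinite_clusters measurable_threshold R o. Qed.

Lemma nb_event_zero_one o : lambda (nb_event o) = 0%E \/ lambda (nb_event o) = 1%E.
Proof.
apply: zero_one_law => // n; rewrite /nb_event.
apply/seteqP; split=> phi /=;
  rewrite (@nb_infinite_clusters_translate _ (threshold_map eps phi)
    (threshold_map eps (shift n phi)) (n%:Z, 0))// => a b;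
  rewrite !open_edge_threshold; congr (_ && _);
  by rewrite /neighbors !inE -!(addrAC _ _ (n%:Z, 0)) !(inj_eq (addIr _)).
Qed.

(** The number takes countably many values, which cannot all have
    probability 0. *)
Lemma exists_nb_event1 : exists o, lambda (nb_event o) = 1%E.
Proof.
apply: contrapT => /forallNP no1.
have [phi nphi] : exists phi, forall o, ~ nb_event o phi.
  apply: (@exists_outside_null _ _ _ lambda) => o; split=> //.
  by have [//|/no1] := nb_event_zero_one o.
have [k] := nb_infinite_clusters_nat_or_pinfty (threshold_map eps phi) R.
exact: nphi.
Qed.

(** Rational angles make these modifications countable in number, while they
    still bring a value as close as desired to any larger one. *)
Definition rotations (g : seq (vertex * rat)) (phi : V) : V :=
  foldr (fun vr => rotate_at vr.1 (ratr vr.2)) phi g.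

Let unit_angles (g : seq (vertex * rat)) := all (fun vr => 0 <= vr.2 <= 1) g.

Lemma rotations_preserve g : unit_angles g -> preserves lambda (rotations g).
Proof.
elim: g => [_ C mC|vr g IH /andP[/andP[r0 r1] /IH{}IH] C mC]; first by split.
have [mC1 C1] : measurable (rotate_at vr.1 (ratr vr.2) @^-1` C) /\
    lambda (rotate_at vr.1 (ratr vr.2) @^-1` C) = lambda C.
  by apply: rotate_at_preserves => //; rewrite ler0q r0 -(ler_rat R) ?rmorph1 in r1 *.
by have [mC2 C2] := IH _ mC1; split; [exact: mC2|rewrite -C1 -C2].
Qed.

(** The configurations that keep [n] infinite clusters after all rotations of
    finitely many coordinates have full measure and are stable under raising, so
    that [finite_number_le1] applies to them. *)
Lemma nb_event1_le1 n : lambda (nb_event (Some n)) = 1%E -> (n <= 1)%N.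
Proof.
move=> n1.
have [phi Gphi] : exists phi, forall g, unit_angles g ->
    nb_event (Some n) (rotations g phi).
  have [g|phi nphi] := @exists_outside_null _ _ _ lambda (seq (vertex * rat))
    (fun g => if unit_angles g then ~` (rotations g @^-1` nb_event (Some n)) else set0).
    case: ifP => [/rotations_preserve/(_ _ (measurable_nb_event (Some n)))[m p]|_];
      last by rewrite measure0.
    split; first exact: measurableC.
    by rewrite probability_setC// p n1 subee.
  by exists phi => g gu; have := nphi g; rewrite gu => /contrapT.
pose G := [set psi : V | forall g, unit_angles g -> nb_event (Some n) (rotations g psi)].
apply: (@finite_number_le1 R eps eps_gt0 n G _ _ phi Gphi) => [psi Gpsi|].
  exact: (Gpsi [::]).
move=> psi v lo hi Gpsi psilo lohi hi1.
have p0 := height_ge0 psi v.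
have lohi' : lo - height psi v < hi - height psi v by rewrite ltrD2r.
(* the sum stays below 1, so this rotation acts on the value as a translation *)
have [r] := rat_in_itvoo lohi'; rewrite in_itv /= => /andP[r1 r2].
have r01 : 0 <= (ratr r : R) <= 1 by apply/andP; split; lra.
exists (rotate_at v (ratr r) psi).
  move=> g gu; have := Gpsi (rcons g (v, r)); rewrite /rotations foldr_rcons /=; apply.
  rewrite /unit_angles all_rcons /= -/(unit_angles g) gu andbT.
  by move: r01; rewrite -!(ler_rat R) rmorph0 rmorph1.
split; first by move=> a av; rewrite /rotate_at (negbTE av).
rewrite height_rotate_at// eqxx /rotate.
have -> : (height psi v == 1) = false by apply/eqP; lra.
have -> : height psi v + ratr r < 1 by lra.
by apply/andP; split; lra.
Qed.

End almost_sure_number.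

Theorem theorem4p3 (R : realType) (lambda : probability (vertex_config R) R)
    (hlambda : lebesgue_product_measure lambda)
    (eps : R) (heps0 : 0 < eps) (heps1 : eps <= 1) :
  exists2 k : \bar R, [\/ k = 0%E, k = 1%E | k = +oo%E] &
    {ae edge_law lambda eps, forall w : edge_config,
       nb_infinite_clusters R w = k}.
Proof.
have [k k1] := exists_nb_event1 hlambda eps.
exists (if k is Some n then n%:R%:E else +oo%E).
  case: k k1 => [n|_]; last by constructor 3.
  move=> /(nb_event1_le1 hlambda heps0).
  by case: n => [|[|//]] _; [constructor 1|constructor 2].
have mE := @measurable_nb_infinite_clusters _ edge_config id measurable_edge R k.
eexists; split; [exact: measurableC mE| |by []].
rewrite /edge_law /pushforward -preimage_setC probability_setC.
  by rewrite [X in (1 - X)%E](_ : _ = 1%E) ?subee.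
exact: (measurable_nb_infinite_clusters (measurable_threshold eps)).
Qed.
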